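(* Let $\mathbb{K}$ be a field, $n \in \mathbb{N}$, let $X = X_1 \times \cdots \times X_n$ and $Y = Y_1 \times \cdots \times Y_n$ with $X_i, Y_i$ finite subsets of $\mathbb{K}$, let $P := X \setminus Y$, and let $f \in \mathbb{K}[x_1,\ldots,x_n] \setminus \{0\}$. For $i \in \{1,\ldots,n\}$ let $a_i := |X_i|$ and $b_i := |Y_i|$. (1) Let \[ A := \{ (y_1,\ldots,y_n) \in \mathbb{N}^n \mid \forall i: 1 \le y_i \le a_i,\ \exists i: y_i > b_i,\ \textstyle\sum_{i=1}^n y_i \ge \sum_{i=1}^n a_i - \deg(f) \}. \] If $P \setminus \mathbb{V}(f) \neq \emptyset$, then $|P \setminus \mathbb{V}(f)| \ge \min\{ \prod_{i=1}^n y_i - \prod_{i=1}^n \min(y_i, b_i) \mid (y_1,\ldots,y_n) \in A\}$. (2) Assume that $\deg_{x_i}(f) < a_i$ for all $i$. Let \[ B := \{ (y_1,\ldots,y_n) \in \mathbb{N}^n \mid \forall i: a_i - \deg_{x_i}(f) \le y_i \le a_i,\ \textstyle\sum_{i=1}^n y_i = \sum_{i=1}^n a_i - \deg(f) \}. \] If $P \setminus \mathbb{V}(f) \neq \emptyset$, then $|P \setminus \mathbb{V}(f)| \ge \min\{ \prod_{i=1}^n y_i - \prod_{i=1}^n \min(y_i, b_i) \mid (y_1,\ldots,y_n) \in B\}$.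
   Context: $\mathbb{V}(f) := \{\mathbf{a} \in \mathbb{K}^n \mid f(\mathbf{a}) = 0\}$. $\deg(f)$ is the total degree and $\deg_{x_i}(f)$ the degree in the variable $x_i$. $\mathbb{N} = \{1,2,\ldots\}$.
   Formalization: Part (1) is proved under the added hypothesis that for each i, Y_i ⊆ X_i or |Y_i| < |X_i|; without it (1) is false, e.g. X={0,1,2}×{0,1}, Y={0,1,3}×{0}, f=x_2−1 over the rationals has one nonzero on P but the bound is 2. *)

(* Defs.v *)
From HB Require Import structures.
From mathcomp Require Import all_boot all_order all_algebra finmap mpoly.

Set Implicit Arguments.
Unset Strict Implicit.
Unset Printing Implicit Defensive.

Import GRing.Theory.
Local Open Scope ring_scope.
Local Open Scope fset_scope.

Definition box (K : choiceType) (n : nat) (X : 'I_n -> {fset K}) :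
    {fset {ffun 'I_n -> K}} :=
  [fset [ffun i => val (h i)] |
     h : {dffun forall i : 'I_n, X i} in {: {dffun forall i : 'I_n, X i}}].

Lemma in_box (K : choiceType) (n : nat) (X : 'I_n -> {fset K})
    (v : {ffun 'I_n -> K}) :
  (v \in box X) = [forall i, v i \in X i].
Proof.
apply/imfsetP/forallP => [[h _ ->] i|vX].
  by rewrite ffunE; apply: valP.
exists [ffun i => [` vX i]] => //.
by apply/ffunP => i; rewrite !ffunE.
Qed.

Definition zeros (K : fieldType) (n : nat) (f : {mpoly K[n]}) :
    pred {ffun 'I_n -> K} :=
  [pred v : {ffun 'I_n -> K} | f.@[v] == 0].

(* [msize f] is one more than the total degree of a nonzero [f]. *)
Definition tdeg (K : fieldType) (n : nat) (f : {mpoly K[n]}) : nat :=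
  (msize f).-1.

Definition vdeg (K : fieldType) (n : nat) (f : {mpoly K[n]}) (i : 'I_n) : nat :=
  (\max_(m <- msupp f) m i)%N.

(* Truncated subtraction agrees with integer subtraction wherever it is used
   below: a negative lower bound on a sum of naturals is as vacuous as the
   bound 0; the differences in [setB] are nonnegative when
   [vdeg f i < a i] for all [i]; and [minn (y i) (b i) <= y i]. *)
Definition setA (K : fieldType) (n : nat) (f : {mpoly K[n]})
    (a b y : 'I_n -> nat) : Prop :=
  [/\ forall i, (1 <= y i <= a i)%N,
      exists i, (y i > b i)%N
    & (\sum_(i < n) y i >= \sum_(i < n) a i - tdeg f)%N].

Definition setB (K : fieldType) (n : nat) (f : {mpoly K[n]})
    (a y : 'I_n -> nat) : Prop :=
  (forall i, a i - vdeg f i <= y i <= a i)%N /\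
  (\sum_(i < n) y i = \sum_(i < n) a i - tdeg f)%N.

Definition gap (n : nat) (b y : 'I_n -> nat) : nat :=
  (\prod_(i < n) y i - \prod_(i < n) minn (y i) (b i))%N.

Definition is_min (T : Type) (D : T -> Prop) (F : T -> nat) (m : nat) : Prop :=
  (exists2 y, D y & F y = m) /\ (forall y, D y -> (m <= F y)%N).

(* Trivially true when [Y i] is a subset of [X i] for all [i]. Some such
   condition is needed for the bound over [setA]: for
   X = {0,1,2} x {0,1}, Y = {0,1,3} x {0} and f = x_2 - 1 over the rationals,
   f has one nonzero, (2,0), on X \ Y, but the only members of [setA] are
   (2,2) and (3,2), with gaps 2 and 3. *)
Definition admissible (K : choiceType) (n : nat) (X Y : 'I_n -> {fset K}) :
    Prop :=
  forall i, Y i `<=` X i \/ (#|` Y i| < #|` X i|)%N.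

(* Main.v *)
Require Import Defs.
From Stdlib Require Import Classical_Prop.
From HB Require Import structures.
From mathcomp Require Import all_boot all_order all_algebra finmap mpoly.

Set Implicit Arguments.
Unset Strict Implicit.
Unset Printing Implicit Defensive.

Import Order.TTheory GRing.Theory.
Local Open Scope ring_scope.
Local Open Scope fset_scope.

(* For [Y i `<=` X i], the ideal of the punctured grid [box X `\` box Y] has
   standard monomials [k] with [k i < a i] for all [i] and [k i + b i < a i]
   for some [i].  First, [f] reduces to a polynomial [r] with the same values
   on the punctured grid, whose leading monomial [m] is standard and divides a
   monomial of [f].  The multiples ['X_[e] * r] with [e + m] standard have
   distinct standard leading monomials; no nonzero combination of them vanishes
   on the punctured grid, because multiplying it by [\prod_(c <- Y i) ('X_i - c)]
   for a suitable [i] would contradict the Combinatorial Nullstellensatz.  So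
   their number, the gap of [a - m], is at most the number of nonzeros.  In (2)
   [a - m] is then lowered to the prescribed sum, which only lowers the gap.
   For general [Y] the bound is obtained for [X i `&` Y i]; if the resulting
   tuple [y] is not in [setA] for [Y], raising one entry to [b i + 1] puts it
   there without raising the bound. *)

(** * Products of linear factors and leading-term reduction *)

(** Stronger than a monic leading term: the other monomials must divide [k], not merely precede it
    in the monomial order. *)
Definition monic_below (K : fieldType) (n : nat) (p : {mpoly K[n]})
    (k : 'X_{1..n}) : Prop :=
  p@_k = 1 /\ forall m, m \in msupp p -> (m <= k)%MM.

Lemma monic_below_mlead (K : fieldType) (n : nat) (p : {mpoly K[n]}) k :
  monic_below p k -> mlead p = k.
Proof.
case=> pk1 p_le.
have kp : k \in msupp p by rewrite mcoeff_msupp pk1 oner_eq0.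
apply/le_anti/andP; split; last exact: msupp_le_mlead.
apply/lem_leo/p_le/mlead_supp.
by apply: contraTneq kp => ->; rewrite msupp0.
Qed.

Lemma monic_below_neq0 (K : fieldType) (n : nat) (p : {mpoly K[n]}) k :
  monic_below p k -> p != 0.
Proof.
by case=> pk1 _; apply: contra_eq_neq pk1 => ->; rewrite mcoeff0 eq_sym oner_eq0.
Qed.

Lemma monic_belowM (K : fieldType) (n : nat) (p q : {mpoly K[n]}) k l :
  monic_below p k -> monic_below q l -> monic_below (p * q) (k + l)%MM.
Proof.
move=> pk ql; split.
  rewrite -(monic_below_mlead pk) -(monic_below_mlead ql) mleadcM.
  rewrite (monic_below_mlead pk) (monic_below_mlead ql).
  by case: pk ql => [-> _] [-> _]; rewrite mulr1.
move=> m /msuppM_le/allpairsP[[m1 m2] /= [m1p m2q ->]].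
apply/mnm_lepP => i; rewrite !mnmDE; apply: leq_add.
  by have /mnm_lepP := pk.2 _ m1p.
by have /mnm_lepP := ql.2 _ m2q.
Qed.

Lemma monic_below_prod (K : fieldType) (n : nat) (T : Type) (s : seq T)
    (F : T -> {mpoly K[n]}) (k : T -> 'X_{1..n}) :
  (forall x, monic_below (F x) (k x)) ->
  monic_below (\prod_(x <- s) F x) (\sum_(x <- s) k x)%MM.
Proof.
move=> Fk; elim/big_rec2: _ => [|x p l _]; last exact: monic_belowM.
by split=> [|m]; rewrite ?mcoeff1 ?eqxx // msupp1 inE => /eqP ->; apply: lepm_refl.
Qed.

Lemma monic_below_linear (K : fieldType) (n : nat) (i : 'I_n) (c : K) :
  monic_below ('X_i - c%:MP) U_(i)%MM.
Proof.
split.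
  rewrite mcoeffB mcoeffX mcoeffC eqxx (_ : (_ == 0%MM) = false) ?mulr0 ?subr0 //.
  by apply/eqP => /mnmP/(_ i); rewrite mnm1E mnm0E eqxx.
move=> m /msuppB_le; rewrite mem_cat msuppX msuppC inE => /orP[/eqP-> |].
  exact: lepm_refl.
by case: ifP => // _; rewrite inE => /eqP ->; apply/mnm_lepP => j; rewrite mnm0E.
Qed.

(** Lists rather than sets: repeated roots can pad the leading exponents up to any prescribed
    monomial. *)
Definition rootprod (K : fieldType) (n : nat) (s : 'I_n -> seq K) :
    {mpoly K[n]} :=
  \prod_(i < n) \prod_(c <- s i) ('X_i - c%:MP).

Lemma monic_below_rootprod (K : fieldType) (n : nat) (s : 'I_n -> seq K) :
  monic_below (rootprod s) [multinom size (s i) | i < n].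
Proof.
rewrite (_ : [multinom _ | _ < _] = (\sum_(i < n) \sum_(c <- s i) U_(i))%MM).
  by do 2![apply: monic_below_prod => ?]; apply: monic_below_linear.
apply/mnmP => j; rewrite mnmE mnm_sumE (bigD1 j) //= mnm_sumE.
rewrite (eq_bigr (fun=> 1%N)); last by move=> c _; rewrite mnm1E eqxx.
rewrite sum1_size big1 ?addn0 // => i ij.
by rewrite mnm_sumE big1 // => c _; rewrite mnm1E (negbTE ij).
Qed.

Lemma rootprod_eq0 (K : fieldType) (n : nat) (s : 'I_n -> seq K)
    (v : 'I_n -> K) i :
  v i \in s i -> (rootprod s).@[v] = 0.
Proof.
move=> vs; rewrite /rootprod rmorph_prod (bigD1 i) //= rmorph_prod /=.
by rewrite (big_rem _ vs) /= mevalB mevalXU mevalC subrr !mul0r.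
Qed.

(* Leading-term reduction, where a member of [P]'s vanishing ideal with leading
   monomial [k] only involves divisors of [k]: hence every monomial of a
   remainder divides a monomial of [f], and no partial degree grows. *)
Lemma reduce_mlead (K : fieldType) (n : nat) (P : ('I_n -> K) -> Prop)
    (D : pred 'X_{1..n}) (f : {mpoly K[n]}) (v0 : 'I_n -> K) :
  (forall k, ~~ D k ->
     exists2 p, monic_below p k & forall v, P v -> p.@[v] = 0) ->
  P v0 -> f.@[v0] != 0 ->
  exists r, [/\ D (mlead r), forall v, P v -> r.@[v] = f.@[v]
    & exists2 M, M \in msupp f & (mlead r <= M)%MM].
Proof.
move=> redD Pv0 fv0.
have: forall m, m \in msupp f -> exists2 M, M \in msupp f & (m <= M)%MM.
  by move=> m mf; exists m => //; apply: lepm_refl.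
have: forall v, P v -> f.@[v] = f.@[v] by [].
(* Well-founded induction on the leading monomial of [r], with two invariants: [r] agrees with [f]
   on [P], and its monomials divide monomials of [f]. *)
move: {1 3}f => r; move: {2}(mlead r) (erefl (mlead r)) => k.
elim/(well_founded_induction (@ltom_wf n)): k r => k IH r rk rf r_le.
(* The nonzero value at [v0] survives, so no remainder becomes 0. *)
have r0 : r != 0.
  by apply: contraNneq fv0 => rE; rewrite -rf // rE meval0.
case: (boolP (D k)) => [Dk|/redD[p pk Pp]].
  by exists r; rewrite rk; split=> //; apply: r_le; rewrite -rk; apply: mlead_supp.
pose r' := r - r@_k *: p.
have r'f v : P v -> r'.@[v] = f.@[v].
  by move=> Pv; rewrite mevalB mevalZ Pp // mulr0 subr0 rf.
have r'_supp m : m \in msupp r' -> m != k /\ (m \in msupp r \/ (m <= k)%MM).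
  move=> mr'; split.
    apply: contraTneq mr' => ->; rewrite mcoeff_msupp negbK mcoeffB mcoeffZ.
    by case: pk => -> _; rewrite mulr1 subrr.
  move: mr' => /msuppB_le; rewrite mem_cat => /orP[|/msuppZ_le/pk.2]; by [left|right].
have kr : k \in msupp r by rewrite -rk; apply: mlead_supp.
apply: (IH (mlead r')) => //.
  have r'0 : r' != 0.
    by apply: contraNneq fv0 => rE; rewrite -r'f // rE meval0.
  have [nk le_k] := r'_supp _ (mlead_supp r'0).
  rewrite lt_neqAle nk /=; case: le_k => [|/lem_leo//].
  by rewrite -rk; apply: msupp_le_mlead.
move=> m /r'_supp[_ []]; first exact: r_le.
move=> mk; have [M Mf kM] := r_le _ kr.
by exists M => //; apply: lepm_trans kM.
Qed.

(** * Combinatorial Nullstellensatz *)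

(** The weights are column [k] of the inverse of the Vandermonde matrix, invertible since the nodes
    are distinct. *)
Lemma power_sum_weights (K : fieldType) (s : seq K) (k : nat) :
  uniq s -> (k < size s)%N ->
  exists w : nat -> K, forall j, (j < size s)%N ->
    \sum_(i < size s) w i * s`_i ^+ j = (j == k)%:R.
Proof.
move=> s_uniq ks; pose x := \row_(i < size s) s`_i.
have Vu : Vandermonde (size s) x \in unitmx.
  rewrite unitmxE det_Vandermonde unitfE.
  apply/prodf_neq0 => i _; apply/prodf_neq0 => j ij.
  by rewrite !mxE subr_eq0 nth_uniq // gtn_eqF.
pose W := invmx (Vandermonde (size s) x) *m delta_mx (Ordinal ks) (0 : 'I_1).
exists (fun i => if insub i is Some i' then W i' 0 else 0) => j js.
transitivity ((Vandermonde (size s) x *m W) (Ordinal js) 0); last first.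
  by rewrite mulmxA mulmxV // mul1mx mxE eqxx andbT.
rewrite mxE; apply: eq_bigr => i _; rewrite insubT // => i_lt.
by rewrite (_ : Sub _ _ = i) ?mxE 1?mulrC //; apply: val_inj.
Qed.

(* The weights of [power_sum_weights] give a linear form supported on the grid
   that maps [q] to its leading coefficient: any other monomial of [q] has
   smaller degree than [mlead q] in some variable. *)
Lemma combinatorial_nullstellensatz (K : fieldType) (n : nat)
    (S : 'I_n -> seq K) (q : {mpoly K[n]}) :
  (forall i, uniq (S i)) -> q != 0 ->
  (forall i, mlead q i < size (S i))%N ->
  exists2 v : {ffun 'I_n -> K}, forall i, v i \in S i & q.@[v] != 0.
Proof.
move=> S_uniq q0 lead_lt.
have [w wP] := fin_all_exists (fun i => power_sum_weights (S_uniq i) (lead_lt i)).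
(* All lists are indexed by the one type ['I_M], so that grid points come from finite functions; [Q]
   restricts to valid positions. *)
pose M := (\max_(i < n) size (S i))%N.
have S_le i : (size (S i) <= M)%N by apply: leq_bigmax.
pose Q i := [pred j : 'I_M | (j < size (S i))%N].
pose v (j : {ffun 'I_n -> 'I_M}) := [ffun i => (S i)`_(j i)].
have [j /andP[jQ vj0]|all0] := pickP [pred j | (j \in family Q) && (q.@[v j] != 0)].
  exists (v j) => // i; rewrite ffunE; apply: mem_nth.
  by move/familyP: jQ => /(_ i).
have: mleadc q == 0; last by rewrite mleadc_eq0 (negbTE q0).
apply/eqP; transitivity
    (\sum_(j in family Q) (\prod_i w i (j i)) * q.@[v j]); last first.
  apply: big1 => j jQ; move: (all0 j); rewrite /= jQ /= => /negbFE/eqP ->.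
  by rewrite mulr0.
under eq_bigr do rewrite mevalE mulr_sumr.
rewrite exchange_big /= (bigD1_seq (mlead q)) ?mlead_supp ?msupp_uniq //=.
have sumE m : \sum_(j in family Q)
      (\prod_i w i (j i)) * (q@_m * \prod_i v j i ^+ m i) =
    q@_m * \prod_i \sum_(j < size (S i)) w i j * (S i)`_j ^+ m i.
  under [in RHS]eq_bigr => i _ do
    rewrite (big_ord_widen _ (fun j => w i j * (S i)`_j ^+ m i) (S_le i)).
  rewrite (bigA_distr_big_dep Q (fun i (j : 'I_M) => w i j * (S i)`_j ^+ m i)).
  rewrite mulr_sumr; apply: eq_bigr => j _.
  rewrite mulrCA -big_split /=; congr (_ * _).
  by apply: eq_bigr => i _; rewrite ffunE.
rewrite sumE big1 ?mulr1 => [|i _]; last by rewrite wP ?eqxx.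
rewrite big_seq_cond big1 ?addr0 // => m /andP[mq m_neq]; rewrite sumE.
have [i m_lt] : exists i, (m i < mlead q i)%N.
  apply/existsP; rewrite -[X in is_true X]negbK negb_exists.
  apply: contra m_neq => /forallP m_ge; apply/eqP/le_anti.
  rewrite msupp_le_mlead //=; apply/lem_leo/mnm_lepP => i.
  by rewrite leqNgt; apply: m_ge.
rewrite (bigD1 i) //= wP; last exact: ltn_trans m_lt (lead_lt i).
by rewrite (ltn_eqF m_lt) mul0r mulr0.
Qed.

(** * Standard monomials of the punctured grid *)

Definition footprint (n : nat) (a b : 'I_n -> nat) : pred 'X_{1..n} :=
  fun k => [forall i, k i < a i]%N && [exists i, k i + b i < a i]%N.

(** The factor with roots [Y i] raises the leading exponent only in variable [i], where the
    footprint leaves room for it; a nonzero of the product in [box X] has its coordinate [i] outside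
    [Y i], so it lies in the punctured grid. *)
Lemma vanishing_mlead (K : fieldType) (n : nat) (X Y : 'I_n -> {fset K})
    (q : {mpoly K[n]}) :
  (forall v, v \in box X `\` box Y -> q.@[v] = 0) -> q != 0 ->
  ~~ footprint (fun i => #|` X i|) (fun i => #|` Y i|) (mlead q).
Proof.
move=> q_van q0; apply/negP => /andP[/forallP lead_lt /existsP[i lead_i]].
pose s j : seq K := if j == i then enum_fset (Y i) else [::].
have sP := monic_below_rootprod s.
have s0 := monic_below_neq0 sP.
have [j||j|v vX] := @combinatorial_nullstellensatz K n X (q * rootprod s).
- exact: fset_uniq.
- by rewrite mulf_neq0.
- rewrite mleadM // (monic_below_mlead sP) mnmDE mnmE /s.
  by case: eqP => [->|_] //=; rewrite addn0.
rewrite mevalM; case: (boolP (v i \in Y i)) => [vY|vY].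
  by rewrite (@rootprod_eq0 _ _ _ _ i) ?mulr0 ?eqxx // /s eqxx.
rewrite q_van ?mul0r ?eqxx // inE !in_box; apply/andP; split.
  by apply/negP => /forallP/(_ i); apply/negP.
by apply/forallP.
Qed.

(** If some [k i] reaches the size of [X i], the roots [X i] in that one variable suffice. Otherwise
    every [k i] reaches the size of [X i] minus [Y i], and each point of [box X] off [box Y] has a
    coordinate in such a difference. Extra roots 0 fill up the exponents. *)
Lemma footprint_reducer (K : fieldType) (n : nat) (X Y : 'I_n -> {fset K})
    (k : 'X_{1..n}) :
  (forall i, Y i `<=` X i) ->
  ~~ footprint (fun i => #|` X i|) (fun i => #|` Y i|) k ->
  exists2 p, monic_below p k &
    forall v : 'I_n -> K, [forall i, v i \in X i] && ~~ [forall i, v i \in Y i] ->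
      p.@[v] = 0.
Proof.
move=> YX.
have rootprodP (s : 'I_n -> seq K) : (forall i, size (s i) = k i) ->
    monic_below (rootprod s) k.
  move=> sk; rewrite [X in monic_below _ X](_ : k = [multinom size (s i) | i < n]).
    exact: monic_below_rootprod.
  by apply/mnmP => i; rewrite mnmE sk.
rewrite negb_and => /orP[/forallPn[i] | /existsPn k_ge].
  rewrite -leqNgt => k_ge.
  pose s j := if j == i then enum_fset (X i) ++ nseq (k i - #|` X i|) 0
    else nseq (k j) 0.
  exists (rootprod s).
    apply: rootprodP => j; rewrite /s; case: eqP => [->|_]; last exact: size_nseq.
    by rewrite size_cat size_nseq subnKC.
  move=> v /andP[/forallP vX _]; apply: (@rootprod_eq0 _ _ _ _ i).
  by rewrite /s eqxx mem_cat vX.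
pose s i := (X i `\` Y i : seq K) ++ nseq (k i - #|` X i `\` Y i|) 0.
exists (rootprod s).
  apply: rootprodP => i; rewrite size_cat size_nseq subnKC //.
  move: (k_ge i); rewrite -leqNgt => k_i.
  by rewrite cardfsDS // leq_subLR addnC.
move=> v /andP[/forallP vX /forallPn[i vY]]; apply: (@rootprod_eq0 _ _ _ _ i).
by rewrite mem_cat inE vY vX.
Qed.

(** * The gap as a count of shifts, and the bound on nonzeros *)

Lemma card_ord_geq (y c : nat) : (#|[set e : 'I_y | c <= e]| = y - c)%N.
Proof.
have -> : [set e : 'I_y | (c <= e)%N] = ~: [set e : 'I_y | (e < c)%N].
  by apply/setP => e; rewrite !inE -leqNgt.
rewrite cardsCs setCK card_ord; have [cy|yc] := leqP c y.
  congr (_ - _)%N; rewrite -sum1dep_card -(big_ord_widen y (fun=> 1%N) cy).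
  by rewrite sum1_card card_ord.
rewrite (_ : [set e : 'I_y | (e < c)%N] = setT) ?cardsT ?card_ord ?subnn.
  by apply/esym/eqP; rewrite subn_eq0 ltnW.
by apply/setP => e; rewrite !inE (ltn_trans (ltn_ord e)).
Qed.

(** The excluded [e] form a product of intervals from [y i - b i] up to [y i], of lengths
    [minn (y i) (b i)]. *)
Lemma card_gap (n : nat) (b y : 'I_n -> nat) :
  #|[set e : {dffun forall i, 'I_(y i)} | [exists i, e i + b i < y i]%N]| =
  gap b y.
Proof.
pose C i := [set e : 'I_(y i) | (y i - b i <= e)%N].
have -> : [set e : {dffun forall i, 'I_(y i)} | [exists i, e i + b i < y i]%N]
    = ~: setXn C.
  apply/setP => e; rewrite in_setC in_setXn inE negb_forall.
  by apply: eq_existsb => i; rewrite inE leq_subLR addnC -ltnNge.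
rewrite cardsCs setCK cardsXn /gap; congr (_ - _)%N.
  have <- : #|setXn (fun i => [set: 'I_(y i)])| = (\prod_(i < n) y i)%N.
    by rewrite cardsXn; apply: eq_bigr => i _; rewrite cardsT card_ord.
  by apply: eq_card => e; rewrite in_setXn inE; apply/esym/forallP => i; rewrite inE.
by apply: eq_bigr => i _; rewrite card_ord_geq minnE.
Qed.

(** More unknowns than equations: [c] is a nonzero vector in the left kernel of the matrix of values
    of [F]. *)
Lemma vanishing_combination (K : fieldType) (T : finType) (V : eqType)
    (E : {set T}) (s : seq V) (F : T -> V -> K) :
  (size s < #|E|)%N ->
  exists2 c : T -> K, exists2 e, e \in E & c e != 0 &
    forall v, v \in s -> \sum_(e in E) c e * F e v = 0.
Proof.
move=> sE.
pose A : 'M_(#|E|, size s) := \matrix_(i, j) F (enum_val i) (tnth (in_tuple s) j).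
have [i ker_i] : exists i, row i (kermx A) != 0.
  apply/existsP; rewrite -negb_forall; apply: contraTN sE => /forallP ker0.
  have: kermx A == 0.
    by apply/eqP/row_matrixP => i; rewrite row0; apply/eqP.
  rewrite kermx_eq0 -leqNgt => /eqP <-; exact: rank_leq_col.
set u := row i _ in ker_i.
have uA : u *m A = 0 by apply/sub_kermxP/row_sub.
have /rV0Pn[j uj] := ker_i.
have e0E := enum_valP j.
exists (fun e => u 0 (enum_rank_in e0E e)).
  by exists (enum_val j) => //; rewrite enum_valK_in.
move=> v vs; have [l ->] : exists l, v = tnth (in_tuple s) l by apply/tnthP.
transitivity ((u *m A) 0 l); last by rewrite uA mxE.
rewrite mxE big_enum_val /=.
by apply: eq_bigr => k _; rewrite enum_valK_in [A _ _]mxE.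
Qed.

(** If [s] had fewer points than there are shifts, a nonzero combination [h] of shift monomials
    would vanish on [s]. Since [r] vanishes on the rest of the punctured grid, [h * r] would vanish
    on all of it, with a standard leading monomial. *)
Lemma gap_le_nonzeros (K : fieldType) (n : nat) (X Y : 'I_n -> {fset K})
    (r : {mpoly K[n]}) (s : seq {ffun 'I_n -> K}) :
  r != 0 ->
  footprint (fun i => #|` X i|) (fun i => #|` Y i|) (mlead r) ->
  (forall v, v \in box X `\` box Y -> r.@[v] != 0 -> v \in s) ->
  (gap (fun i => #|` Y i|) (fun i => #|` X i| - mlead r i) <= size s)%N.
Proof.
move=> r0 /andP[/forallP lead_lt _] r_nz; rewrite leqNgt; apply/negP.
rewrite -card_gap; set E := [set _ | _] => sE.
pose mon (e : {dffun forall i, 'I_(#|` X i| - mlead r i)}) : 'X_{1..n} :=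
  [multinom (e i : nat) | i < n].
have mon_inj : injective mon.
  move=> e e' /mnmP ee'; apply/ffunP => i; apply: val_inj.
  by move: (ee' i); rewrite !mnmE.
have [c [e0 e0E c0] c_van] :=
  vanishing_combination
    (fun e (v : {ffun 'I_n -> K}) => ('X_[mon e] : {mpoly K[n]}).@[v]) sE.
pose h : {mpoly K[n]} := \sum_(e in E) c e *: 'X_[mon e].
have h0 : h != 0.
  apply: contraNneq c0 => /(congr1 (mcoeff (mon e0))).
  rewrite mcoeff0 raddf_sum (bigD1 e0) //= mcoeffZ mcoeffX eqxx mulr1.
  rewrite big1 ?addr0 => [-> //|e /andP[_ ee0]].
  by rewrite mcoeffZ mcoeffX (inj_eq mon_inj) (negbTE ee0) mulr0.
have hr_van v : v \in box X `\` box Y -> (h * r).@[v] = 0.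
  move=> vP; rewrite mevalM; have [->|/r_nz] := eqVneq r.@[v] 0.
    by rewrite mulr0.
  move=> /(_ vP)/c_van; rewrite /h raddf_sum /= => hv0.
  by under eq_bigr do rewrite mevalZ; rewrite hv0 mul0r.
have /negP := vanishing_mlead hr_van (mulf_neq0 h0 r0); apply.
rewrite mleadM //.
have [e eE ->] : exists2 e, e \in E & mlead h = mon e.
  have /msupp_sum_le/flatten_mapP[e] := mlead_supp h0.
  rewrite mem_filter => /andP[eE _] /msuppZ_le; rewrite msuppX inE => /eqP ->.
  by exists e.
move: eE; rewrite inE => /existsP[i ei].
apply/andP; split; first apply/forallP => j; last apply/existsP; last exists i.
  by have := ltn_ord (e j); rewrite ltn_subRL mnmDE mnmE addnC.
by move: ei; rewrite ltn_subRL mnmDE mnmE addnA [X in (X + _)%N]addnC.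
Qed.

(** [M] is kept because [m <= M] bounds both the total and the partial degrees of [m] by those of
    [f]. *)
Lemma footprint_bound (K : fieldType) (n : nat) (X Y : 'I_n -> {fset K})
    (f : {mpoly K[n]}) :
  let N := [fset v in box X `\` box Y | v \notin zeros f] in
  (forall i, Y i `<=` X i) -> N != fset0 ->
  exists m M, [/\ footprint (fun i => #|` X i|) (fun i => #|` Y i|) m,
    M \in msupp f, (m <= M)%MM &
    (gap (fun i => #|` Y i|) (fun i => #|` X i| - m i) <= #|` N|)%N].
Proof.
move=> N YX /fset0Pn[v0]; rewrite !inE /= !in_box => /andP[v0P fv0].
pose P (v : 'I_n -> K) : Prop :=
  [forall i, v i \in X i] && ~~ [forall i, v i \in Y i].
have P_box (v : {ffun 'I_n -> K}) : P v <-> v \in box X `\` box Y.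
  by rewrite !inE !in_box andbC.
have Pv0 : P v0 by rewrite /P andbC.
have [r [Dr rf [M Mf rM]]] :=
  reduce_mlead (fun k => footprint_reducer (k := k) YX) Pv0 fv0.
exists (mlead r), M; split=> //; apply: gap_le_nonzeros => //.
  by apply: contraNneq fv0 => r0; rewrite -rf // r0 meval0.
move=> v vP rv; rewrite /N !inE /=; move: (vP); rewrite !inE => ->.
by rewrite -rf ?rv //; apply/P_box.
Qed.

(** * Monotonicity of the gap and choice of tuples *)

(** Read through [card_gap], enlarging [y] only enlarges the counted set. *)
Lemma leq_gap (n : nat) (b y z : 'I_n -> nat) :
  (forall i, y i <= z i)%N -> (gap b y <= gap b z)%N.
Proof.
move=> yz; rewrite -!card_gap.
pose g (e : {dffun forall i, 'I_(y i)}) : {dffun forall i, 'I_(z i)} :=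
  [ffun i => widen_ord (yz i) (e i)].
have g_inj : injective g.
  move=> e e' /ffunP ee'; apply/ffunP => i; apply: val_inj.
  by move: (ee' i); rewrite !ffunE => /(congr1 val).
rewrite -(card_imset _ g_inj); apply/subset_leq_card/subsetP => _ /imsetP[e + ->].
rewrite !inE => /existsP[i ei]; apply/existsP; exists i.
by rewrite ffunE /=; apply: leq_trans (yz i).
Qed.

Lemma gap_anti (n : nat) (b c y : 'I_n -> nat) :
  (forall i, c i <= b i)%N -> (gap b y <= gap c y)%N.
Proof.
move=> cb; apply/leq_sub2l/leq_prod => i _.
by rewrite leq_min geq_minl /= (leq_trans (geq_minr _ _)).
Qed.

(** With [R] the product of the other [y j], the left side is [(b i + 1) * R - b i * R = R], and the
    right side is at least [(y i - c i) * R]. *)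
Lemma gap_replace (n : nat) (b c y : 'I_n -> nat) (i : 'I_n) :
  (forall j, y j <= b j)%N -> (c i < y i)%N ->
  (gap b (fun j => if j == i then (b i).+1 else y j) <= gap c y)%N.
Proof.
move=> yb cy; rewrite /gap !(bigD1 i (P := xpredT)) //= eqxx.
have -> : (\prod_(j < n | j != i) (if j == i then (b i).+1 else y j) =
    \prod_(j < n | j != i) y j)%N by apply: eq_bigr => j /negbTE ->.
have -> : (\prod_(j < n | j != i) minn (if j == i then (b i).+1 else y j) (b j) =
    \prod_(j < n | j != i) y j)%N.
  by apply: eq_bigr => j /negbTE ->; apply/minn_idPl.
rewrite (minn_idPr (leqnSn _)) (minn_idPr (ltnW cy)).
set R := (\prod_(j < n | j != i) y j)%N.
rewrite mulSn addnK; apply: (@leq_trans (y i * R - c i * R)).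
  by rewrite -mulnBl leq_pmull // subn_gt0.
by apply/leq_sub2l/leq_mul => //; apply: leq_prod => j _; apply: geq_minl.
Qed.

(** Starting from [z], an entry still above [l] is lowered by one until the excess [d] over [t] is
    used up. *)
Lemma exists_sum_between (n : nat) (l z : 'I_n -> nat) (t : nat) :
  (forall i, l i <= z i)%N -> (\sum_(i < n) l i <= t <= \sum_(i < n) z i)%N ->
  exists2 y : 'I_n -> nat, forall i, (l i <= y i <= z i)%N &
    (\sum_(i < n) y i = t)%N.
Proof.
move=> lz /andP[lt tz]; have [d zE] : exists d, (\sum_(i < n) z i = t + d)%N.
  by exists (\sum_(i < n) z i - t)%N; rewrite subnKC.
elim: d z zE lz {tz} => [|d IH] z zE lz.
  by exists z => [i|]; rewrite ?lz ?leqnn // zE addn0.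
have [i lzi] : exists i, (l i < z i)%N.
  apply/existsP; apply: contraTT lt => /existsPn zl; rewrite -ltnNge.
  apply: (@leq_trans (\sum_(i < n) z i)); first by rewrite zE addnS ltnS leq_addr.
  by apply: leq_sum => i _; rewrite leqNgt.
pose z' j := if j == i then (z i).-1 else z j.
have z'z j : (z' j <= z j)%N.
  by rewrite /z'; case: eqP => [->|_] //; apply: leq_pred.
have [||y y_btw yE] := IH z'.
- apply/eqP; rewrite -eqSS -addnS -zE (bigD1 i) //= [in eqbRHS](bigD1 i) //=.
  rewrite /z' eqxx -addSn prednK ?(leq_ltn_trans _ lzi) // eqn_add2l.
  by apply/eqP/eq_bigr => j /negbTE ->.
- move=> j; rewrite /z'; case: eqP => [->|_] //.
  by rewrite -ltnS prednK // (leq_ltn_trans _ lzi).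
exists y => // j; have /andP[-> /=] := y_btw j.
by move/leq_trans; apply.
Qed.

(** Descent on the value of [F]; [D] is an arbitrary predicate, so excluded middle decides whether a
    smaller value exists. *)
Lemma exists_is_min (T : Type) (D : T -> Prop) (F : T -> nat) (y : T) (N : nat) :
  D y -> (F y <= N)%N -> exists2 m, is_min D F m & (m <= N)%N.
Proof.
move=> Dy yN; move: {2}(F y) (leqnn (F y)) => d.
elim: d y Dy yN => [|d IH] y Dy yN yd.
  by exists (F y) => //; split=> [|z _]; [exists y | apply: leq_trans yd _].
have [[z Dz zy]|min_y] := classic (exists2 z, D z & (F z < F y)%N).
  by apply: (IH z) => //; [apply: leq_trans (ltnW zy) yN | rewrite -ltnS (leq_trans zy)].
exists (F y) => //; split=> [|z Dz]; first by exists y.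
by rewrite leqNgt; apply/negP => zy; apply: min_y; exists z.
Qed.

Lemma mdeg_le_tdeg (K : fieldType) (n : nat) (f : {mpoly K[n]}) m :
  m \in msupp f -> (mdeg m <= tdeg f)%N.
Proof. by move=> /msize_mdeg_lt; rewrite /tdeg; case: (msize f). Qed.

Lemma tdeg_le_sum_vdeg (K : fieldType) (n : nat) (f : {mpoly K[n]}) :
  f != 0 -> (tdeg f <= \sum_(i < n) vdeg f i)%N.
Proof.
move=> f0; rewrite /tdeg -mlead_deg //= mdegE; apply: leq_sum => i _.
by apply: (leq_bigmax_seq (F := fun m : 'X_{1..n} => m i)) => //; apply: mlead_supp.
Qed.

Lemma box_diff_capr (K : choiceType) (n : nat) (X Y : 'I_n -> {fset K}) :
  box X `\` box (fun i => X i `&` Y i) = box X `\` box Y.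
Proof.
apply/fsetP => v; rewrite !inE !in_box.
case: (boolP [forall i, v i \in X i]) => [/forallP vX|]; last by rewrite !andbF.
rewrite !andbT; congr (~~ _); apply: eq_forallb => i.
by rewrite inE vX.
Qed.

Theorem theorem2p6 (K : fieldType) (n : nat) (n_gt0 : (0 < n)%N)
    (X Y : 'I_n -> {fset K}) (f : {mpoly K[n]}) (f_neq0 : f != 0) :
  let P := box X `\` box Y in
  let N := [fset v in P | v \notin zeros f] in
  let a := fun i => #|` X i| in
  let b := fun i => #|` Y i| in
  (admissible X Y -> N != fset0 ->
     exists2 m, is_min (setA f a b) (gap b) m & (m <= #|` N|)%N) /\
  ((forall i, vdeg f i < a i)%N -> N != fset0 ->
     exists2 m, is_min (setB f a) (gap b) m & (m <= #|` N|)%N).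
Proof.
move=> P N a b.
pose c i := #|` X i `&` Y i|.
have cb i : (c i <= b i)%N by apply/fsubset_leq_card/fsubsetIr.
have bound : N != fset0 -> exists m M, [/\ footprint a c m,
    M \in msupp f, (m <= M)%MM & (gap c (fun i => a i - m i) <= #|` N|)%N].
  move=> N0; have := @footprint_bound K n X (fun i => X i `&` Y i) f.
  rewrite box_diff_capr; apply=> // i; exact: fsubsetIl.
split=> [XY | vdeg_lt] /bound[m [M [/andP[/forallP ma /existsP[i mi]] Mf mM gapN]]].
  pose y i := (a i - m i)%N.
  have y_sum : (\sum_(i < n) a i - tdeg f <= \sum_(i < n) y i)%N.
    rewrite sumnB => [|j _]; last exact: ltnW.
    by rewrite leq_sub2l // -mdegE (leq_trans (lemc_mdeg (lem_leo mM))) ?mdeg_le_tdeg.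
  have y_btw j : (1 <= y j <= a j)%N by rewrite subn_gt0 ma leq_subr.
  have [/existsP[j yj]|/existsPn y_le] := boolP [exists j, b j < y j]%N.
    apply: (exists_is_min (y := y)); last exact: leq_trans (gap_anti _ cb) gapN.
    by split=> //; exists j.
  have y_le_b j : (y j <= b j)%N by rewrite leqNgt.
  have ciy : (c i < y i)%N by rewrite ltn_subRL.
  (* If [Y i] lay inside [X i], then [c i = b i], against [c i < y i <= b i]. So admissibility
     leaves room for the entry [b i + 1]. *)
  have ba : (b i < a i)%N.
    case: (XY i) => // /fsetIidPr YX.
    by move: (leq_trans ciy (y_le_b i)); rewrite /c YX ltnn.
  apply: exists_is_min (leq_trans (gap_replace y_le_b ciy) gapN).
  split=> [j| |].
  - by case: eqP => [->|_].
  - by exists i; rewrite eqxx.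
  - apply: leq_trans y_sum _; apply: leq_sum => j _.
    by case: eqP => [->|_] //; apply: leqW.
(* [m j <= M j <= vdeg f j], so [a - m] dominates the lower bounds of [setB]. *)
have l_le j : (a j - vdeg f j <= a j - m j)%N.
  rewrite leq_sub2l //; move/mnm_lepP: mM => /(_ j)/leq_trans; apply.
  exact: (leq_bigmax_seq (F := fun m : 'X_{1..n} => m j)).
(* The prescribed sum is reachable: [tdeg f] lies between the sum of the [m j] and the sum of the
   [vdeg f j]. *)
have [|y y_btw y_sum] := exists_sum_between (t := (\sum_(j < n) a j - tdeg f)%N) l_le.
  rewrite !sumnB => [|j _|j _]; [|exact: ltnW..].
  by rewrite !leq_sub2l ?tdeg_le_sum_vdeg // -mdegE
    (leq_trans (lemc_mdeg (lem_leo mM))) ?mdeg_le_tdeg.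
apply: (exists_is_min (y := y)).
  by split=> // j; have /andP[-> /leq_trans ->] := y_btw j; rewrite ?leq_subr.
apply: leq_trans (leq_trans (gap_anti y cb) _) gapN.
by apply: leq_gap => j; have /andP[] := y_btw j.
Qed.
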